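(* Let $p\ge1$ and $n\ge3$ be integers. For the subvariety $\mathfrak{G}_1\subset\Bbbk^{n^2p}$ of the Gelfand-Tsetlin variety for $Y_p(\mathfrak{gl}_n)$, $$\mathfrak{G}_1=\mathbb{W}_{1}\cup\mathbb{W}_{2}\quad\text{whenever } p=1,2;$$ $$\mathfrak{G}_1=\mathbb{W}^{p}\cup\mathbb{W}_{1}\cup\mathbb{W}_{2}\quad\text{whenever } p\geq 3.$$
   Context: $\Bbbk$ is an algebraically closed field of characteristic zero; $V(S)$ denotes the zero set in affine space of a set $S$ of polynomials. Coordinates on $\Bbbk^{n^2p}$ are $X_{ij}^{(k)}$, $1\le i,j\le n$, $1\le k\le p$ (the generators of the associated graded algebra of the restricted Yangian $Y_p(\mathfrak{gl}_n)$ of level $p$). Put $X_{ij}(u)=\delta_{ij}u^p+\sum_{k=1}^pX_{ij}^{(k)}u^{p-k}$, and for $1\le m\le n$ define $\overline{d}_{mj}$, $1\le j\le mp$, by $\det(X_{ij}(u))_{i,j=1}^m=u^{mp}+\overline{d}_{m1}u^{mp-1}+\cdots+\overline{d}_{m,mp}$. Polynomials $p_{ij}$ ($1\le i\le n$): $p_{1j}=X_{11}^{(j)}$ for $1\le j\le p$. $p_{2j}=X_{22}^{(j)}-\sum_{t=1}^{j-1}X_{12}^{(t)}X_{21}^{(j-t)}$ for $1\le j\le p$. For $1\le j\le 3p$, $$p_{3j}=\epsilon_j-\sum_{\substack{s+t=j\\1\le s,t\le p}}\left(X_{13}^{(s)}X_{31}^{(t)}+X_{23}^{(s)}X_{32}^{(t)}\right)+\sum_{\substack{r+s+t=j\\1\le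 r,s,t\le p}}\left(X_{12}^{(r)}X_{23}^{(s)}X_{31}^{(t)}+X_{13}^{(r)}X_{21}^{(s)}X_{32}^{(t)}\right)-\sum_{\substack{r+s+t=j\\1\le r,s,t\le p}}X_{13}^{(r)}X_{22}^{(s)}X_{31}^{(t)},$$ where $\epsilon_j=X_{33}^{(j)}$ if $j\le p$ and $\epsilon_j=0$ if $j>p$, and where in the last sum the terms with $s=1$ are omitted when $j\le p+1$. For $4\le i\le n$ and $1\le j\le ip$, $p_{ij}=\overline{d}_{ij}$. The variety $\mathfrak{G}_1$ is $$\mathfrak{G}_1:=V\left(\{p_{ij}\}_{i=1,2;\ 1\le j\le p}\cup\{X_{12}^{(i)}\}_{i=1}^{p}\cup\{p_{ij}\}_{3\le i\le n,\ 1\le j\le ip}\right)\subset\Bbbk^{n^2p}.$$ Let $\mathbf{W}=\bigcup_{i=1}^p\{X_{11}^{(i)},X_{12}^{(i)},X_{22}^{(i)}\}$ and $\mathbf{P}=\{p_{ij}\}_{4\le i\le n,\ 1\le j\le ip}$ (empty if $n=3$). Define subvarieties of $\Bbbk^{n^2p}$: $\mathbb{W}^p:=V\left(\mathbf{W}\cup\{p_{3j}\}_{j=1}^{3p-3}\cup\{X_{32}^{(p)},X_{21}^{(p)},X_{13}^{(p)}\}\cup\mathbf{P}\right)$. $\mathbb{W}_1:=\bigcup_{s=1}^{p+1}\mathbb{W}_{1s}$, where $\mathbb{W}_{11}:=V(\mathbf{W}\cup\{p_{3j}\}_{j=1}^{2p}\cup\{X_{13}^{(t)}\}_{t=1}^{p}\cup\mathbf{P})$;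 for $2\le s\le p$, $\mathbb{W}_{1s}:=V(\mathbf{W}\cup\{p_{3j}\}_{j=1}^{2p}\cup\{X_{13}^{(t)}\}_{t=s}^{p}\cup\{X_{21}^{(t)}\}_{t=p-(s-2)}^{p}\cup\mathbf{P})$; $\mathbb{W}_{1,p+1}:=V(\mathbf{W}\cup\{p_{3j}\}_{j=1}^{2p}\cup\{X_{21}^{(t)}\}_{t=1}^{p}\cup\mathbf{P})$. $\mathbb{W}_2:=\bigcup_{s=2}^{p+1}\mathbb{W}_{2s}$, where for $2\le s\le p$, $\mathbb{W}_{2s}:=V(\mathbf{W}\cup\{p_{3j}\}_{j=1}^{2p}\cup\{X_{21}^{(t)}\}_{t=s}^{p}\cup\{X_{32}^{(t)}\}_{t=p-(s-2)}^{p}\cup\mathbf{P})$; $\mathbb{W}_{2,p+1}:=V(\mathbf{W}\cup\{p_{3j}\}_{j=1}^{2p}\cup\{X_{32}^{(t)}\}_{t=1}^{p}\cup\mathbf{P})$. *)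

(* Defs.v *)
From HB Require Import structures.
From mathcomp Require Import all_boot all_order all_algebra.
From mathcomp Require Import mpoly.
From mathcomp Require Import classical_sets.

Set Implicit Arguments.
Unset Strict Implicit.
Unset Printing Implicit Defensive.

Import GRing.Theory.
Local Open Scope ring_scope.
Local Open Scope classical_set_scope.

(* All indices i, j, k, m, s, t below are natural numbers counted from 1. *)

Definition zeroset (K : comNzRingType) (N : nat) (S : set {mpoly K[N]}) :
  set ('I_N -> K) := [set x | forall f, S f -> f.@[x] = 0].

Definition fam (T : Type) (f : nat -> T) (a b : nat) : set T :=
  [set f j | j in [set j | (a <= j <= b)%N]].

Section GelfandTsetlin.
Variables (K : closedFieldType) (n p : nat).

Local Notation A := {mpoly K[n * n * p]}.

(* X i j k is the coordinate X_ij^(k) if 1 <= i, j <= n and 1 <= k <= p,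
   and the junk value 0 otherwise. *)
Definition X (i j k : nat) : A :=
  if [pick c : 'I_n * 'I_n * 'I_p |
       [&& c.1.1.+1 == i, c.1.2.+1 == j & c.2.+1 == k]] is Some c
  then mpolyX K (mnm1 (mxvec_index (mxvec_index c.1.1 c.1.2) c.2))
  else 0.

Definition Xu (i j : nat) : {poly A} :=
  (i == j)%:R *: 'X^p + \sum_(1 <= k < p.+1) X i j k *: 'X^(p - k).

(* The coefficient of u^(mp - j); meaningful for 1 <= j <= mp only, since the
   subtraction is truncated. *)
Definition dbar (m j : nat) : A :=
  (\det (\matrix_(a < m, b < m) Xu a.+1 b.+1))`_(m * p - j).

Definition p1 (j : nat) : A := X 1 1 j.

Definition p2 (j : nat) : A :=
  X 2 2 j - \sum_(1 <= t < j) X 1 2 t * X 2 1 (j - t).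

Definition epsilon (j : nat) : A := if (j <= p)%N then X 3 3 j else 0.

Definition p3 (j : nat) : A :=
  epsilon j
  - (\sum_(1 <= s < p.+1) \sum_(1 <= t < p.+1 | (s + t == j)%N)
       (X 1 3 s * X 3 1 t + X 2 3 s * X 3 2 t))
  + (\sum_(1 <= r < p.+1) \sum_(1 <= s < p.+1)
       \sum_(1 <= t < p.+1 | (r + s + t == j)%N)
         (X 1 2 r * X 2 3 s * X 3 1 t + X 1 3 r * X 2 1 s * X 3 2 t))
  - (\sum_(1 <= r < p.+1)
       \sum_(1 <= s < p.+1 | ~~ ((s == 1)%N && (j <= p.+1)%N))
         \sum_(1 <= t < p.+1 | (r + s + t == j)%N)
           X 1 3 r * X 2 2 s * X 3 1 t).

Definition pp (i j : nat) : A :=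
  match i with
  | 1 => p1 j
  | 2 => p2 j
  | 3 => p3 j
  | _ => dbar i j
  end.

Definition G1 : set ('I_(n * n * p) -> K) :=
  zeroset (fam (pp 1) 1 p `|` fam (pp 2) 1 p `|` fam (X 1 2) 1 p
    `|` \bigcup_(i in [set i | (3 <= i <= n)%N]) fam (pp i) 1 (i * p)).

Definition Wset : set A :=
  fam (X 1 1) 1 p `|` fam (X 1 2) 1 p `|` fam (X 2 2) 1 p.

Definition Pset : set A :=
  \bigcup_(i in [set i | (4 <= i <= n)%N]) fam (pp i) 1 (i * p).

(* For p = 0 the bound 3p - 3 is truncated; this variety is used for p >= 3. *)
Definition Wp : set ('I_(n * n * p) -> K) :=
  zeroset (Wset `|` fam (pp 3) 1 (3 * p - 3)
    `|` [set X 3 2 p; X 2 1 p; X 1 3 p] `|` Pset).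

Definition W1s (s : nat) : set ('I_(n * n * p) -> K) :=
  if s == 1%N then
    zeroset (Wset `|` fam (pp 3) 1 (2 * p) `|` fam (X 1 3) 1 p `|` Pset)
  else if s == p.+1 then
    zeroset (Wset `|` fam (pp 3) 1 (2 * p) `|` fam (X 2 1) 1 p `|` Pset)
  else
    zeroset (Wset `|` fam (pp 3) 1 (2 * p) `|` fam (X 1 3) s p
      `|` fam (X 2 1) (p - (s - 2)) p `|` Pset).

Definition W1 : set ('I_(n * n * p) -> K) :=
  \bigcup_(s in [set s | (1 <= s <= p.+1)%N]) W1s s.

Definition W2s (s : nat) : set ('I_(n * n * p) -> K) :=
  if s == p.+1 then
    zeroset (Wset `|` fam (pp 3) 1 (2 * p) `|` fam (X 3 2) 1 p `|` Pset)
  else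
    zeroset (Wset `|` fam (pp 3) 1 (2 * p) `|` fam (X 2 1) s p
      `|` fam (X 3 2) (p - (s - 2)) p `|` Pset).

Definition W2 : set ('I_(n * n * p) -> K) :=
  \bigcup_(s in [set s | (2 <= s <= p.+1)%N]) W2s s.

End GelfandTsetlin.

Arguments G1 : clear implicits.
Arguments Wp : clear implicits.
Arguments W1 : clear implicits.
Arguments W2 : clear implicits.

(* Main.v *)
(** On either side all of X_11, X_12, X_22 vanish, so p_{3j} reduces to the
    coefficient of v^j in eps - ae - cd + abd, where a, b, c, d, e are the
    generating polynomials of X_13, X_21, X_23, X_32, X_31.  If none of
    a, b, d is zero and r, s, t are their degrees, the coefficient of v^(r+s+t)
    in abd is a product of nonzero scalars, while eps and ae + cd do not reach
    degree r+s+t if r+s+t > 2p or s = p.  Hence the equations p_{3j} = 0 force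
    r+s+t <= 2p and s < p: either r = p and s+t <= p (a point of W_2), or t = p
    and r+s <= p (a point of W_1), or r, s, t < p (a point of W^p, and of W_1
    when p <= 2). *)
Require Import Defs.
From mathcomp Require Import all_boot all_order all_algebra.
From mathcomp Require Import mpoly zify.
From mathcomp Require Import classical_sets.

Set Implicit Arguments.
Unset Strict Implicit.
Unset Printing Implicit Defensive.

Local Open Scope classical_set_scope.

(** * Zero sets and top coefficients *)

Lemma zerosetUP (K : comNzRingType) (N : nat) (S T : set {mpoly K[N]})
    (x : 'I_N -> K) :
  zeroset (S `|` T) x <-> zeroset S x /\ zeroset T x.
Proof.
split=> [h|[hS hT] f [/hS|/hT] //].
by split=> f Sf; apply: h; [left|right].
Qed.

Lemma zeroset_famP (K : comNzRingType) (N : nat) (f : nat -> {mpoly K[N]})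
    (a b : nat) (x : 'I_N -> K) :
  zeroset (fam f a b) x <-> forall j, (a <= j <= b)%N -> ((f j).@[x] = 0)%R.
Proof.
split=> [h j hj|h _ [j hj <-]]; last exact: h.
by apply: h; exists j.
Qed.

Lemma meval_sum (R : comNzRingType) (N : nat) (x : 'I_N -> R) (I : Type)
    (r : seq I) (P : pred I) (F : I -> {mpoly R[N]}) :
  ((\sum_(i <- r | P i) F i).@[x] = \sum_(i <- r | P i) (F i).@[x])%R.
Proof. exact: GRing.raddf_sum. Qed.

(** Stands in for the degree of the polynomial with coefficient [f k] in degree [k]: the first case
    is the zero polynomial, and in the second [r] is the degree. *)
Lemma last_nonzero (V : nmodType) (f : nat -> V) (p : nat) :
  (forall k, (1 <= k <= p)%N -> f k = 0%R) \/
  exists r, [/\ (1 <= r <= p)%N, f r != 0%R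
              & forall k, (r < k <= p)%N -> f k = 0%R].
Proof.
elim: p => [|p [IH|[r [hr fr IH]]]]; first by left=> k; lia.
- have [f0|fp] := eqVneq (f p.+1) 0%R.
    left=> k hk; have [->//|nk] := eqVneq k p.+1.
    by apply: IH; lia.
  by right; exists p.+1; split=> // [|k]; lia.
- right; have [f0|fp] := eqVneq (f p.+1) 0%R.
    exists r; split=> // [|k hk]; first by lia.
    have [->//|nk] := eqVneq k p.+1.
    by apply: IH; lia.
  by exists p.+1; split=> // [|k]; lia.
Qed.

(** Leading coefficients multiply: any other triple with the same sum exceeds [r], [s] or [t] in
    some entry, and the factor there vanishes. *)
Lemma triple_sum_last (R : pzRingType) (a b d : nat -> R) (p r s t : nat) :
  (1 <= r <= p)%N -> (1 <= s <= p)%N -> (1 <= t <= p)%N ->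
  (forall k, (r < k <= p)%N -> a k = 0%R) ->
  (forall k, (s < k <= p)%N -> b k = 0%R) ->
  (forall k, (t < k <= p)%N -> d k = 0%R) ->
  (\sum_(1 <= i < p.+1) \sum_(1 <= j < p.+1)
     \sum_(1 <= k < p.+1 | (i + j + k == r + s + t)%N) a i * b j * d k
   = a r * b s * d t)%R.
Proof.
move=> hr hs ht a0 b0 d0.
have term0 i j k : (1 <= i <= p)%N -> (1 <= j <= p)%N -> (1 <= k <= p)%N ->
    (i + j + k == r + s + t)%N -> (i, j, k) <> (r, s, t) ->
    (a i * b j * d k = 0)%R.
  move=> hi hj hk /eqP e ne.
  have [ri|ri] := ltnP r i; first by rewrite a0 ?GRing.mul0r //; lia.
  have [sj|sj] := ltnP s j; first by rewrite b0 ?GRing.mulr0 ?GRing.mul0r //; lia.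
  have [tk|tk] := ltnP t k; first by rewrite d0 ?GRing.mulr0 //; lia.
  by case: ne; congr (_, _, _); lia.
rewrite (bigD1_seq r) ?mem_index_iota ?iota_uniq //=.
rewrite [X in (_ + X)%R](_ : _ = 0%R) ?GRing.addr0; last first.
  rewrite big_nat_cond big1 // => i /andP[hi ni]; rewrite big_nat big1 // => j hj.
  rewrite big_nat_cond big1 // => k /andP[hk e].
  by apply: term0 => // -[ei _ _]; rewrite ei eqxx in ni.
rewrite (bigD1_seq s) ?mem_index_iota ?iota_uniq //=.
rewrite [X in (_ + X)%R](_ : _ = 0%R) ?GRing.addr0; last first.
  rewrite big_nat_cond big1 // => j /andP[hj nj]; rewrite big_nat_cond big1 // => k /andP[hk e].
  by apply: term0 => // -[ej _]; rewrite ej eqxx in nj.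
rewrite (eq_bigl (pred1 t)); last by move=> k; rewrite /= eqn_add2l.
by rewrite -big_filter filter_pred1_uniq ?iota_uniq ?mem_index_iota // big_seq1.
Qed.

(** * The equations p_{3j} at a point where [Wset] vanishes *)

Section Points.
Variables (K : closedFieldType) (n p : nat) (x : 'I_(n * n * p) -> K).

Local Notation ev i j k := ((X K n p i j k).@[x])%R.
Local Notation vanishes i j a b :=
  (forall k, (a <= k <= b)%N -> ev i j k = 0%R).

Lemma zeroset_WsetP :
  zeroset (@Wset K n p) x <->
  [/\ vanishes 1 1 1 p, vanishes 1 2 1 p & vanishes 2 2 1 p].
Proof.
rewrite /Wset; split=> [/zerosetUP[/zerosetUP[]]|[? ? ?]].
  by move=> /zeroset_famP ? /zeroset_famP ? /zeroset_famP ?.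
by do ![apply/zerosetUP; split=> //]; apply/zeroset_famP.
Qed.

Hypothesis Wx : zeroset (@Wset K n p) x.

Lemma p3_eval (j : nat) :
  ((p3 K n p j).@[x] =
    (epsilon K n p j).@[x]
    - (\sum_(1 <= s < p.+1) \sum_(1 <= t < p.+1 | (s + t == j)%N)
         (ev 1 3 s * ev 3 1 t + ev 2 3 s * ev 3 2 t))
    + \sum_(1 <= r < p.+1) \sum_(1 <= s < p.+1)
        \sum_(1 <= t < p.+1 | (r + s + t == j)%N)
          ev 1 3 r * ev 2 1 s * ev 3 2 t)%R.
Proof.
have [_ x12 x22] := zeroset_WsetP.1 Wx.
rewrite /p3 mevalB mevalD mevalB !meval_sum /=.
rewrite [X in (_ - X)%R = _](_ : _ = 0%R) ?GRing.subr0; last first.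
  rewrite big1 // => r _; rewrite meval_sum /= big_nat_cond big1 // => s /andP[hs _].
  by rewrite meval_sum big1 // => t _; rewrite /= !mevalM x22 // GRing.mulr0 GRing.mul0r.
congr (_ - _ + _)%R; apply: eq_big_nat => r hr; rewrite meval_sum /=.
  by apply: eq_bigr => t _; rewrite mevalD !mevalM.
apply: eq_bigr => s _; rewrite meval_sum /=; apply: eq_bigr => t _.
by rewrite mevalD !mevalM x12 // !GRing.mul0r GRing.add0r.
Qed.

Lemma p3_eval_high (j : nat) : (2 * p < j)%N ->
  ((p3 K n p j).@[x] =
    \sum_(1 <= r < p.+1) \sum_(1 <= s < p.+1)
      \sum_(1 <= t < p.+1 | (r + s + t == j)%N)
        ev 1 3 r * ev 2 1 s * ev 3 2 t)%R.
Proof.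
move=> hj; rewrite p3_eval /epsilon ifF ?meval0; last by lia.
rewrite [X in (_ - X + _)%R](_ : _ = 0%R) ?GRing.subr0 ?GRing.add0r //.
rewrite big_nat big1 // => s hs.
by rewrite big_nat_cond big_pred0 // => t; apply/negbTE; lia.
Qed.

(** Serves the inclusions into [G1]: beyond degree 2p only abd is left, so a vanishing factor in
    each of its terms yields the equation. *)
Lemma p3_high_zero (j : nat) : (2 * p < j)%N ->
  (forall r s t, (1 <= r <= p)%N -> (1 <= s <= p)%N -> (1 <= t <= p)%N ->
     (r + s + t)%N = j ->
     [\/ ev 1 3 r = 0%R, ev 2 1 s = 0%R | ev 3 2 t = 0%R]) ->
  ((p3 K n p j).@[x] = 0)%R.
Proof.
move=> hj h; rewrite p3_eval_high //.
rewrite big_nat big1 // => r hr; rewrite big_nat big1 // => s hs.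
rewrite big_nat_cond big1 // => t /andP[ht /eqP e].
by have [] := h r s t hr hs ht e => ->; rewrite ?GRing.mulr0 ?GRing.mul0r.
Qed.

Lemma p3_low_to_full (m : nat) :
  zeroset (fam (pp K n p 3) 1 m) x ->
  (forall j, (m < j <= 3 * p)%N -> ((p3 K n p j).@[x] = 0)%R) ->
  zeroset (fam (pp K n p 3) 1 (3 * p)) x.
Proof.
move=> /zeroset_famP lo hi; apply/zeroset_famP => j hj /=.
by have [jm|mj] := leqP j m; [apply: lo; lia | apply: hi; lia].
Qed.

Lemma p3_full_to_low (m : nat) : (m <= 3 * p)%N ->
  zeroset (fam (pp K n p 3) 1 (3 * p)) x ->
  zeroset (fam (pp K n p 3) 1 m) x.
Proof. by move=> hm /zeroset_famP h; apply/zeroset_famP => j hj; apply: h; lia. Qed.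

Lemma last_degrees_bound (r s t : nat) :
  zeroset (fam (pp K n p 3) 1 (3 * p)) x ->
  (1 <= r <= p)%N -> (1 <= s <= p)%N -> (1 <= t <= p)%N ->
  ev 1 3 r != 0%R -> ev 2 1 s != 0%R -> ev 3 2 t != 0%R ->
  vanishes 1 3 r.+1 p -> vanishes 2 1 s.+1 p -> vanishes 3 2 t.+1 p ->
  (r + s + t <= 2 * p)%N /\ (s < p)%N.
Proof.
move=> /zeroset_famP hp3 hr hs ht nr ns nt zr zs zt.
have [sp|sp] : ((r + s + t <= 2 * p) && (s < p) \/
                (2 * p < r + s + t) || (s == p))%N by lia.
  by apply/andP.
have nabd : (ev 1 3 r * ev 2 1 s * ev 3 2 t != 0)%R by rewrite !GRing.mulf_neq0.
case/eqP: nabd; rewrite -(triple_sum_last hr hs ht zr zs zt).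
have /= := hp3 (r + s + t)%N ltac:(lia).
(* In both cases r + s + t > p, so eps does not contribute. *)
rewrite p3_eval /epsilon ifF ?meval0; last by lia.
rewrite [X in (_ - X + _)%R](_ : _ = 0%R) ?GRing.subr0 ?GRing.add0r //.
rewrite big_nat big1 // => i hi.
rewrite big_nat_cond big1 // => k /andP[hk /eqP e].
(* If r + s + t > 2p there is no such pair [i], [k]. If s = p, then i + k = r + p + t with i, k <= p
   forces i > r and k > t, which kills a factor of each product. *)
by rewrite zr ?[ev 3 2 k]zt ?GRing.mulr0 ?GRing.mul0r ?GRing.addr0 //; lia.
Qed.

End Points.

(** * The inclusions in both directions *)

Section Decomposition.
Variables (K : closedFieldType) (n p : nat).
Hypotheses (hp : (1 <= p)%N) (hn : (3 <= n)%N).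

(** Once X_12 vanishes, p_{2j} and X_22^(j) take the same value; the family for i = 3 is split off
    from those for i >= 4. *)
Lemma G1E : G1 K n p =
  zeroset (@Wset K n p `|` fam (pp K n p 3) 1 (3 * p) `|` @Pset K n p).
Proof.
apply/seteqP; split=> x.
- move=> /zerosetUP[/zerosetUP[/zerosetUP[]]].
  move=> /zeroset_famP h1 /zeroset_famP h2 /zeroset_famP h12 h3.
  apply/zerosetUP; split; last by move=> f [i hi hf]; apply: h3; exists i => //=; move: hi => /=; lia.
  apply/zerosetUP; split; last by move=> f hf; apply: h3; exists 3%N.
  apply/zeroset_WsetP; split=> // j hj; rewrite -(h2 j hj) /= /p2 mevalB meval_sum.
  rewrite big_nat big1 ?GRing.subr0 // => t ht.
  by rewrite /= mevalM h12 ?GRing.mul0r //; lia.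
- move=> /zerosetUP[/zerosetUP[Wx h3] hP]; have [x11 x12 x22] := (zeroset_WsetP x).1 Wx.
  apply/zerosetUP; split; last first.
    move=> f [i /= hi hf]; have [i3|i3] := eqVneq i 3%N.
      by rewrite i3 in hf; apply: h3.
    by apply: hP; exists i => //=; lia.
  apply/zerosetUP; split; last exact/zeroset_famP.
  apply/zerosetUP; split; first exact/zeroset_famP.
  apply/zeroset_famP => j hj; rewrite /= /p2 mevalB x22 // meval_sum.
  rewrite big_nat big1 ?GRing.subr0 // => t ht.
  by rewrite /= mevalM x12 ?GRing.mul0r //; lia.
Qed.

Lemma W1_sub_G1 : W1 K n p `<=` G1 K n p.
Proof.
rewrite G1E => x [s /= hs]; rewrite /W1s.
case: eqP => [_|s1]; last case: eqP => [_|sp].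
- move=> /zerosetUP[/zerosetUP[/zerosetUP[Wx h3] /zeroset_famP ha] hP].
  do ![apply/zerosetUP; split=> //].
  apply: p3_low_to_full h3 _ => j hj; apply: p3_high_zero => // [|r k t hr *].
    by lia.
  by apply: Or31; apply: ha.
- move=> /zerosetUP[/zerosetUP[/zerosetUP[Wx h3] /zeroset_famP hb] hP].
  do ![apply/zerosetUP; split=> //].
  apply: p3_low_to_full h3 _ => j hj; apply: p3_high_zero => // [|r k t *].
    by lia.
  by apply: Or32; apply: hb.
- move=> /zerosetUP[/zerosetUP[/zerosetUP[/zerosetUP[Wx h3] /zeroset_famP ha] /zeroset_famP hb] hP].
  do ![apply/zerosetUP; split=> //].
  apply: p3_low_to_full h3 _ => j hj; apply: p3_high_zero => // [|r k t *].
    by lia.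
  (* Since t <= p and r + k + t > 2p, r + k > p; hence r < s forces k >= p - (s - 2). *)
  have [rs|sr] := ltnP r s; last by apply: Or31; apply: ha; lia.
  by apply: Or32; apply: hb; lia.
Qed.

Lemma W2_sub_G1 : W2 K n p `<=` G1 K n p.
Proof.
rewrite G1E => x [s /= hs]; rewrite /W2s.
case: eqP => [_|sp].
- move=> /zerosetUP[/zerosetUP[/zerosetUP[Wx h3] /zeroset_famP hd] hP].
  do ![apply/zerosetUP; split=> //].
  apply: p3_low_to_full h3 _ => j hj; apply: p3_high_zero => // [|r k t *].
    by lia.
  by apply: Or33; apply: hd.
- move=> /zerosetUP[/zerosetUP[/zerosetUP[/zerosetUP[Wx h3] /zeroset_famP hb] /zeroset_famP hd] hP].
  do ![apply/zerosetUP; split=> //].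
  apply: p3_low_to_full h3 _ => j hj; apply: p3_high_zero => // [|r k t *].
    by lia.
  (* Here r <= p gives k + t > p, so k < s forces t >= p - (s - 2). *)
  have [ks|sk] := ltnP k s; last by apply: Or32; apply: hb; lia.
  by apply: Or33; apply: hd; lia.
Qed.

Lemma Wp_sub_G1 : (3 <= p)%N -> Wp K n p `<=` G1 K n p.
Proof.
move=> p3; rewrite G1E => x.
move=> /zerosetUP[/zerosetUP[/zerosetUP[Wx h3] /zerosetUP[/zerosetUP[d0 b0] a0]] hP].
  do ![apply/zerosetUP; split=> //].
apply: p3_low_to_full h3 _ => j hj; apply: p3_high_zero => // [|r k t *].
  (* The bound p >= 3 gives 3p - 3 >= 2p, so every remaining [j] exceeds 2p. *)
  by lia.
have [rp|rp] := eqVneq r p; first by rewrite rp; apply: Or31; apply: a0.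
have [kp|kp] := eqVneq k p; first by rewrite kp; apply: Or32; apply: b0.
(* The sum is at least 3p - 2 and r, k <= p - 1, so t >= p. *)
have -> : t = p by lia.
by apply: Or33; apply: d0.
Qed.

Lemma G1_sub (x : 'I_(n * n * p) -> K) : G1 K n p x ->
  W1 K n p x \/ W2 K n p x \/ (3 <= p)%N /\ Wp K n p x.
Proof.
rewrite G1E => /zerosetUP[/zerosetUP[Wx h3] hP].
have lo : zeroset (fam (pp K n p 3) 1 (2 * p)) x.
  by apply: p3_full_to_low h3; lia.
have [ha|[r [hr nr zr]]] := last_nonzero (fun k => (X K n p 1 3 k).@[x])%R p.
  left; exists 1%N => //=; rewrite /W1s /=.
  by do ![apply/zerosetUP; split=> //]; apply/zeroset_famP.
have [hb|[s [hs ns zs]]] := last_nonzero (fun k => (X K n p 2 1 k).@[x])%R p.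
  left; exists p.+1; first by rewrite /=; lia.
  rewrite /W1s ifF; last by lia.
  rewrite eqxx.
  by do ![apply/zerosetUP; split=> //]; apply/zeroset_famP.
have [hd|[t [ht nt zt]]] := last_nonzero (fun k => (X K n p 3 2 k).@[x])%R p.
  right; left; exists p.+1; first by rewrite /=; lia.
  rewrite /W2s eqxx.
  by do ![apply/zerosetUP; split=> //]; apply/zeroset_famP.
have [rst sp] := last_degrees_bound Wx h3 hr hs ht nr ns nt zr zs zt.
have [rs|rs] := leqP (r + s) p.
  (* X_13 vanishes above degree r, and the bound for X_21 is p - (r - 1) > s. *)
  left; exists r.+1; first by rewrite /=; lia.
  rewrite /W1s ifF ?ifF; [|lia..].
  do ![apply/zerosetUP; split=> //]; apply/zeroset_famP => // k hk.
  by apply: zs; lia.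
have [st|st] := leqP (s + t) p.
  (* X_21 vanishes above degree s, and the bound for X_32 is p - (s - 1) > t. *)
  right; left; exists s.+1; first by rewrite /=; lia.
  rewrite /W2s ifF; last by lia.
  do ![apply/zerosetUP; split=> //]; apply/zeroset_famP => // k hk.
  by apply: zt; lia.
(* Now r + s > p and s + t > p, so r + s + t <= 2p gives t < p and r < p. With s < p, r + s > p also
   gives r >= 2, whence p >= 3. *)
right; right; split; first by lia.
do ![apply/zerosetUP; split=> //].
- by apply: p3_full_to_low h3; lia.
- by move=> _ ->; apply: zt; lia.
- by move=> _ ->; apply: zs; lia.
- by move=> _ ->; apply: zr; lia.
Qed.

End Decomposition.

Theorem corollary4p20 (K : closedFieldType) (charK0 : [pchar K]%R =i pred0)
    (n p : nat) (hp : (1 <= p)%N) (hn : (3 <= n)%N) :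
  (p = 1%N \/ p = 2%N -> G1 K n p = W1 K n p `|` W2 K n p) /\
  ((3 <= p)%N -> G1 K n p = Wp K n p `|` W1 K n p `|` W2 K n p).
Proof.
split=> hp3; apply/seteqP; split=> x.
- move=> /(G1_sub hp hn) [|[|[p3 _]]]; [by left|by right|lia].
- by move=> [/(W1_sub_G1 hp hn)|/(W2_sub_G1 hp hn)].
- by move=> /(G1_sub hp hn) [|[|[_]]]; [left; right|right|left; left].
- move=> [[/(Wp_sub_G1 hp hn hp3)|/(W1_sub_G1 hp hn)]|/(W2_sub_G1 hp hn)] //.
Qed.
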